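(* Let $\mathbb{O}$ denote the real octonions and let $$\mathcal{A}=\begin{pmatrix} d & a & \overline{b}\\ \overline{a} & e & c\\ b & \overline{c} & f\end{pmatrix},\qquad d,e,f\in\mathbb{R},\quad a,b,c\in\mathbb{O},$$ be a $3\times 3$ octonionic Hermitian matrix such that $\alpha:=(ab)c-a(bc)\neq 0$. Let $K:\mathbb{O}^3\to\mathbb{O}^3$ be the characteristic operator of $\mathcal{A}$, $$K[x]=\mathcal{A}\big(\mathcal{A}(\mathcal{A}x)\big)-(\operatorname{tr}\mathcal{A})\,\mathcal{A}(\mathcal{A}x)+\sigma(\mathcal{A})\,\mathcal{A}x-(\det\mathcal{A})\,x .$$ Suppose that $v\in\mathbb{O}^3$ is an eigenvector of $\mathcal{A}$ with real eigenvalue, i.e. $\mathcal{A}v=\lambda v$ with $\lambda\in\mathbb{R}$, and that $K[v]=rv$ with $r\in\mathbb{R}$. Let $y\in\mathbb{O}^3$ be any other vector satisfying $K[y]=ry$ (for the same $r$). Then $$(vv^\dagger)\big((vv^\dagger)y\big)=(v^\dagger v)\big((vv^\dagger)y\big).$$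
   Context: $\mathbb{O}$ is the 8-dimensional real division algebra of octonions (nonassociative, alternative), with conjugation $p\mapsto\overline{p}$, real part $\operatorname{Re}(p)=\tfrac12(p+\overline p)$ and norm $|p|^2=p\overline p$. Vectors in $\mathbb{O}^3$ are column vectors; $v^\dagger$ is the conjugate transpose (a row vector); matrix products and matrix-vector products are computed by the usual row-by-column rule, with the parentheses as written. Thus $vv^\dagger$ is the $3\times3$ Hermitian matrix with entries $v_i\overline{v_j}$, and $v^\dagger v=\sum_i|v_i|^2\in\mathbb{R}$. An eigenvector is a nonzero vector. For the matrix $\mathcal{A}$ displayed in the claim, $\operatorname{tr}\mathcal{A}=d+e+f$, $\sigma(\mathcal{A})=\tfrac12\big((\operatorname{tr}\mathcal{A})^2-\operatorname{tr}(\mathcal{A}^2)\big)$, and $\det\mathcal{A}$ is the Freudenthal determinant $$\det\mathcal{A}=def+2\operatorname{Re}\big(b(ac)\big)-d|c|^2-e|b|^2-f|a|^2 .$$ *)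

(* Defs.v *)
From HB Require Import structures.
From mathcomp Require Import all_boot all_order all_algebra.
From mathcomp Require Import reals.
From mathcomp Require Import ring.

Set Implicit Arguments.
Unset Strict Implicit.
Unset Printing Implicit Defensive.

Import Order.TTheory GRing.Theory Num.Theory.
Local Open Scope ring_scope.

Section CayleyDickson.
Variables (V : zmodType) (mul : V -> V -> V) (conj : V -> V).
Implicit Types p q : V * V.

Definition cd_mul p q : V * V :=
  (mul p.1 q.1 - mul (conj q.2) p.2, mul q.2 p.1 + mul p.2 (conj q.1)).

Definition cd_conj p : V * V := (conj p.1, - p.2).

End CayleyDickson.

(* The octonions are the third Cayley-Dickson double of [R]; addition and the
   scaling [r *: p] by reals are those of the product real vector space. *)
Definition octonion (R : realType) : Type :=
  ((R^o * R^o) * (R^o * R^o)) * ((R^o * R^o) * (R^o * R^o)).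

HB.instance Definition _ (R : realType) := GRing.Lmodule.on (octonion R).

Section Octonions.
Variable R : realType.
Implicit Types (p q : octonion R) (r d e f : R) (a b c : octonion R).

Definition oct_mul : octonion R -> octonion R -> octonion R :=
  cd_mul (cd_mul (cd_mul *%R id) (cd_conj id)) (cd_conj (cd_conj id)).

Definition oct_conj : octonion R -> octonion R :=
  cd_conj (cd_conj (cd_conj id)).

Definition oct_real r : octonion R := (((r, 0), (0, 0)), ((0, 0), (0, 0))).

(* The real number [r] such that [oct_real r = 2^-1 *: (p + oct_conj p)], see
   [oct_ReE]. *)
Definition oct_Re p : R := p.1.1.1.

(* The real number [|p|^2]; [p * conj p] is itself real, see [oct_sqnormE]. *)
Definition oct_sqnorm p : R := oct_Re (oct_mul p (oct_conj p)).

Definition oct_mulmx m n k (A : 'M[octonion R]_(m, n))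
    (B : 'M[octonion R]_(n, k)) : 'M[octonion R]_(m, k) :=
  \matrix_(i, l) \sum_j oct_mul (A i j) (B j l).

Definition oct_adjmx m n (A : 'M[octonion R]_(m, n)) : 'M[octonion R]_(n, m) :=
  map_mx oct_conj A^T.

(* MathComp only scales matrices by elements of their entry type, hence this
   entrywise scaling by reals. *)
Definition oct_scalemx m n r (A : 'M[octonion R]_(m, n)) :
    'M[octonion R]_(m, n) :=
  map_mx (fun p => r *: p) A.

(* The real number [v^dagger v]; the only entry of that product is itself
   real, see [oct_vsqnormE] and [oct_vsqnorm_sum]. *)
Definition oct_vsqnorm n (v : 'cV[octonion R]_n) : R :=
  oct_Re (oct_mulmx (oct_adjmx v) v 0 0).

Definition oct_herm d e f a b c : 'M[octonion R]_3 :=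
  \matrix_(i, j) nth 0 (nth [::]
    [:: [:: oct_real d;  a;           oct_conj b  ];
        [:: oct_conj a;  oct_real e;  c           ];
        [:: b;           oct_conj c;  oct_real f  ]] i) j.

Definition herm_tr d e f : R := d + e + f.

(* [tr (A A)] is a real octonion, see [tr_oct_herm_sqE]; [oct_Re] extracts the
   corresponding real number. *)
Definition herm_sigma d e f a b c : R :=
  let A := oct_herm d e f a b c in
  2^-1 * (herm_tr d e f ^+ 2 - oct_Re (\tr (oct_mulmx A A))).

Definition herm_det d e f a b c : R :=
  d * e * f + 2 * oct_Re (oct_mul b (oct_mul a c))
  - d * oct_sqnorm c - e * oct_sqnorm b - f * oct_sqnorm a.

Definition char_op d e f a b c (x : 'cV[octonion R]_3) : 'cV[octonion R]_3 :=
  let A := oct_herm d e f a b c in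
  oct_mulmx A (oct_mulmx A (oct_mulmx A x))
  - oct_scalemx (herm_tr d e f) (oct_mulmx A (oct_mulmx A x))
  + oct_scalemx (herm_sigma d e f a b c) (oct_mulmx A x)
  - oct_scalemx (herm_det d e f a b c) x.

End Octonions.

Section OctonionFacts.
Variable R : realType.
Implicit Types (p q : octonion R) (r d e f : R) (a b c : octonion R).

Lemma oct_mulE (x0 x1 x2 x3 x4 x5 x6 x7 y0 y1 y2 y3 y4 y5 y6 y7 : R) :
  oct_mul (((x0, x1), (x2, x3)), ((x4, x5), (x6, x7)))
          (((y0, y1), (y2, y3)), ((y4, y5), (y6, y7))) =
  (((x0*y0 - x1*y1 - x2*y2 - x3*y3 - x4*y4 - x5*y5 - x6*y6 - x7*y7,
     x0*y1 + x1*y0 + x2*y3 - x3*y2 + x4*y5 - x5*y4 - x6*y7 + x7*y6),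
    (x0*y2 - x1*y3 + x2*y0 + x3*y1 + x4*y6 + x5*y7 - x6*y4 - x7*y5,
     x0*y3 + x1*y2 - x2*y1 + x3*y0 + x4*y7 - x5*y6 + x6*y5 - x7*y4)),
   ((x0*y4 - x1*y5 - x2*y6 - x3*y7 + x4*y0 + x5*y1 + x6*y2 + x7*y3,
     x0*y5 + x1*y4 - x2*y7 + x3*y6 - x4*y1 + x5*y0 - x6*y3 + x7*y2),
    (x0*y6 + x1*y7 + x2*y4 - x3*y5 - x4*y2 + x5*y3 + x6*y0 - x7*y1,
     x0*y7 - x1*y6 + x2*y5 + x3*y4 - x4*y3 - x5*y2 + x6*y1 + x7*y0)))
  :> octonion R.
Proof. by do 3![congr pair] => /=; ring. Qed.

Lemma oct_conjE (x0 x1 x2 x3 x4 x5 x6 x7 : R) :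
  oct_conj (((x0, x1), (x2, x3)), ((x4, x5), (x6, x7))) =
  (((x0, - x1), (- x2, - x3)), ((- x4, - x5), (- x6, - x7))) :> octonion R.
Proof. by []. Qed.

Lemma oct_ReE p : oct_real (oct_Re p) = 2^-1 *: (p + oct_conj p).
Proof.
case: p => [[[? ?] [? ?]] [[? ?] [? ?]]].
by do 3![congr pair] => /=; rewrite /oct_Re /GRing.scale /=; field.
Qed.

Lemma oct_real_scale r p : oct_mul (oct_real r) p = r *: p.
Proof.
case: p => [[[? ?] [? ?]] [[? ?] [? ?]]]; rewrite oct_mulE.
by do 3![congr pair] => /=; rewrite /GRing.scale /=; ring.
Qed.

Lemma oct_sqnormE p : oct_real (oct_sqnorm p) = oct_mul p (oct_conj p).
Proof.
case: p => [[[? ?] [? ?]] [[? ?] [? ?]]].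
rewrite /oct_sqnorm !(oct_mulE, oct_conjE) /oct_Re /oct_real /=.
by do 3![congr pair]; ring.
Qed.

Lemma oct_conj_mul p : oct_mul (oct_conj p) p = oct_real (oct_sqnorm p).
Proof.
case: p => [[[? ?] [? ?]] [[? ?] [? ?]]].
rewrite /oct_sqnorm !(oct_mulE, oct_conjE) /oct_Re /oct_real /=.
by do 3![congr pair]; ring.
Qed.

Lemma oct_conjK : involutive (@oct_conj R).
Proof.
by case=> [[[? ?] [? ?]] [[? ?] [? ?]]]; rewrite /oct_conj /cd_conj /= !opprK.
Qed.

Lemma oct_sqnormM p q :
  oct_sqnorm (oct_mul p q) = oct_sqnorm p * oct_sqnorm q.
Proof.
move: p q => [[[? ?] [? ?]] [[? ?] [? ?]]] [[[? ?] [? ?]] [[? ?] [? ?]]].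
rewrite /oct_sqnorm !(oct_mulE, oct_conjE) /oct_Re /=.
by ring.
Qed.

Lemma oct_realD : {morph (@oct_real R) : r s / r + s}.
Proof. by move=> r s; do 3![congr pair] => /=; rewrite addr0. Qed.

Lemma oct_real_sum n (F : 'I_n -> R) :
  oct_real (\sum_i F i) = \sum_i oct_real (F i).
Proof. by apply: (big_morph (@oct_real R) oct_realD). Qed.

Lemma oct_vsqnormM n (v : 'cV[octonion R]_n) :
  oct_mulmx (oct_adjmx v) v 0 0 = oct_real (\sum_i oct_sqnorm (v i 0)).
Proof.
rewrite mxE oct_real_sum; apply: eq_bigr => i _.
by rewrite !mxE oct_conj_mul.
Qed.

Lemma oct_vsqnorm_sum n (v : 'cV[octonion R]_n) :
  oct_vsqnorm v = \sum_i oct_sqnorm (v i 0).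
Proof. by rewrite /oct_vsqnorm oct_vsqnormM. Qed.

Lemma oct_vsqnormE n (v : 'cV[octonion R]_n) :
  oct_real (oct_vsqnorm v) = oct_mulmx (oct_adjmx v) v 0 0.
Proof. by rewrite oct_vsqnorm_sum oct_vsqnormM. Qed.

Lemma oct_adj_herm d e f a b c :
  oct_adjmx (oct_herm d e f a b c) = oct_herm d e f a b c.
Proof.
have conj_real r : oct_conj (oct_real r) = oct_real r.
  by rewrite /oct_conj /cd_conj /= !oppr0.
apply/matrixP => i j; rewrite !mxE.
case: i j => [[|[|[|//]]] ?] [[|[|[|//]]] ?] //=.
all: by rewrite ?conj_real ?oct_conjK.
Qed.

Lemma tr_oct_herm d e f a b c :
  \tr (oct_herm d e f a b c) = oct_real (herm_tr d e f).
Proof.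
by rewrite /mxtrace !big_ord_recl big_ord0 !mxE /= addr0 -!oct_realD addrA.
Qed.

Lemma tr_oct_herm_sqE d e f a b c :
  let A := oct_herm d e f a b c in
  \tr (oct_mulmx A A) = oct_real (oct_Re (\tr (oct_mulmx A A))).
Proof.
move=> A; have herm_A i j : A j i = oct_conj (A i j).
  by rewrite -[LHS](congr1 (fun M : 'M_3 => M j i)
                           (oct_adj_herm d e f a b c)) mxE [_^T _ _]mxE.
suff -> : \tr (oct_mulmx A A) =
          oct_real (\sum_i \sum_j oct_sqnorm (A i j)) by [].
rewrite oct_real_sum; apply: eq_bigr => i _; rewrite oct_real_sum [LHS]mxE.
by apply: eq_bigr => j _; rewrite oct_sqnormE (herm_A i j).
Qed.

End OctonionFacts.

(* Main.v *)
From HB Require Import structures.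
Require Import Defs.
From mathcomp Require Import all_boot all_order all_algebra.
From mathcomp Require Import reals.
From mathcomp Require Import ring lra.

Set Implicit Arguments.
Unset Strict Implicit.
Unset Printing Implicit Defensive.

Import GRing.Theory Num.Theory.
Local Open Scope ring_scope.

(* Write L_p for the left multiplication by p and p' for the conjugate of p.  By
   alternativity the off-diagonal blocks of K cancel, and each diagonal block is
   an alternating form in a, b, c that depends on their imaginary parts only; all
   three blocks are the same.  Replacing a, b, c by orthogonal imaginary
   octonions, nonzero because alpha != 0, this block becomes - 2 L_a L_b L_c up to
   an additive real scalar.  Hence the components of v and y lie in a common
   eigenspace E of L_a L_b L_c.

   If y0 in E is nonzero then E = span(1, a, b, c) y0: when p is orthogonal to
   1, a, b, c, the operator L_p anticommutes with L_a L_b L_c, so p y0 in E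
   forces p y0 = 0.  On E one has (x y')((y z') w) = |y|^2 (x z') w: writing
   x = p y, z = q y, w = t y, the defect is an alternating form in p, q, t
   vanishing on real arguments, so it suffices to evaluate it at (a, b, c), where
   it vanishes by a Moufang identity.  Summing over components gives the
   theorem. *)

(* Locking the product keeps unification from comparing distinct products by
   expanding them into coordinates. *)
HB.lock Definition omul (R : realType) (p q : octonion R) : octonion R :=
  oct_mul p q.

Ltac oct_ring :=
  repeat match goal with
    p : octonion _ |- _ => move: p => [[[? ?] [? ?]] [[? ?] [? ?]]]
  end;
  rewrite /oct_sqnorm /oct_real ?omul.unlock;
  rewrite ?(oct_mulE, oct_conjE) /oct_Re /=;
  do 3?[congr pair]; rewrite /GRing.scale /=; ring.

(** * Octonion arithmetic: cancellation, alternativity, a Moufang identity *)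

Section OctonionAlgebra.
Variable R : realType.
Implicit Types (p q t x y : octonion R) (k : R).

Lemma omulDl : left_distributive (@omul R) +%R.
Proof. by move=> p q t; oct_ring. Qed.

Lemma omulDr : right_distributive (@omul R) +%R.
Proof. by move=> p q t; oct_ring. Qed.

Lemma omulZl k p q : omul (k *: p) q = k *: omul p q.
Proof. by oct_ring. Qed.

Lemma omulZr k p q : omul p (k *: q) = k *: omul p q.
Proof. by oct_ring. Qed.

Lemma omulNl p q : omul (- p) q = - omul p q.
Proof. by rewrite -[in LHS]scaleN1r omulZl scaleN1r. Qed.

Lemma omulNr p q : omul p (- q) = - omul p q.
Proof. by rewrite -[in LHS]scaleN1r omulZr scaleN1r. Qed.

Lemma omul0l p : omul 0 p = 0.
Proof. by rewrite -(scale0r 0) omulZl !scale0r. Qed.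

Lemma omul0r p : omul p 0 = 0.
Proof. by rewrite -(scale0r 0) omulZr !scale0r. Qed.

Lemma omul_reall k p : omul (oct_real k) p = k *: p.
Proof. by rewrite omul.unlock oct_real_scale. Qed.

Lemma omul1l p : omul (oct_real 1) p = p.
Proof. by rewrite omul_reall scale1r. Qed.

Lemma omul_realr p k : omul p (oct_real k) = k *: p.
Proof. by oct_ring. Qed.

Lemma oct_conjM p q : oct_conj (omul p q) = omul (oct_conj q) (oct_conj p).
Proof. by oct_ring. Qed.

Lemma oct_conjD p q : oct_conj (p + q) = oct_conj p + oct_conj q.
Proof. by oct_ring. Qed.

Lemma oct_conjZ k p : oct_conj (k *: p) = k *: oct_conj p.
Proof. by oct_ring. Qed.

Lemma oct_conj_Re p : oct_conj p = oct_real (2 * oct_Re p) - p.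
Proof. by oct_ring. Qed.

Lemma oct_sqnorm_conj p : oct_sqnorm (oct_conj p) = oct_sqnorm p.
Proof. by oct_ring. Qed.

(** The one cancellation law checked in coordinates; its three variants follow by replacing [p] by
    its conjugate and by conjugating both sides, which reverses products. *)
Lemma omulKl p q : omul (oct_conj p) (omul p q) = oct_sqnorm p *: q.
Proof. by oct_ring. Qed.

Lemma omulVKl p q : omul p (omul (oct_conj p) q) = oct_sqnorm p *: q.
Proof. by rewrite -{1}(oct_conjK p) omulKl oct_sqnorm_conj. Qed.

Lemma omulVKr p q : omul (omul q (oct_conj p)) p = oct_sqnorm p *: q.
Proof.
apply: (can_inj (@oct_conjK R)).
by rewrite !oct_conjM oct_conjK omulKl oct_conjZ.
Qed.

Lemma omulKr p q : omul (omul q p) (oct_conj p) = oct_sqnorm p *: q.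
Proof. by rewrite -{1}(oct_conjK p) omulVKr oct_sqnorm_conj. Qed.

Lemma omul_alternative p q : omul p (omul p q) = omul (omul p p) q.
Proof. by oct_ring. Qed.

Lemma omul_ralternative p q : omul (omul p q) q = omul p (omul q q).
Proof. by oct_ring. Qed.

Lemma omul_moufang p q t :
  omul (omul p q) (omul t p) = omul (omul p (omul q t)) p.
Proof. by oct_ring. Qed.

Lemma oct_Re_conj p : oct_Re (oct_conj p) = oct_Re p.
Proof. by oct_ring. Qed.

Lemma oct_conj1 : oct_conj (oct_real 1) = oct_real 1 :> octonion R.
Proof. by oct_ring. Qed.

Lemma oct_ReD p q : oct_Re (p + q) = oct_Re p + oct_Re q.
Proof. by []. Qed.

Lemma oct_ReZ k p : oct_Re (k *: p) = k * oct_Re p.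
Proof. by []. Qed.

Lemma oct_Re_mulC p q : oct_Re (omul p q) = oct_Re (omul q p).
Proof. by oct_ring. Qed.

Lemma oct_Re_mulA p q t :
  oct_Re (omul p (omul q t)) = oct_Re (omul (omul p q) t).
Proof. by oct_ring. Qed.

Lemma oct_sqnorm_eq0 p : oct_sqnorm p = 0 -> p = 0.
Proof.
move: p => [[[p0 p1] [p2 p3]] [[p4 p5] [p6 p7]]].
rewrite /oct_sqnorm oct_conjE oct_mulE /oct_Re /= => n0.
by do 3![congr pair]; nra.
Qed.

Lemma omul_norm p : omul p (oct_conj p) = oct_sqnorm p *: oct_real 1.
Proof. by rewrite -omul_realr omul1l omul.unlock oct_sqnormE. Qed.

Lemma omul_sqnorm p q : oct_sqnorm (omul p q) = oct_sqnorm p * oct_sqnorm q.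
Proof. by rewrite omul.unlock oct_sqnormM. Qed.

End OctonionAlgebra.

Opaque oct_conj oct_Re oct_real.

(** * Real coordinates and the Euclidean inner product *)

Section Coordinates.
Variable R : realType.
Implicit Types (p q : octonion R) (k l : R).

Definition oct_coord (i : bool * bool * bool) p : R :=
  let p2 := if i.1.1 then p.1 else p.2 in
  let p1 := if i.1.2 then p2.1 else p2.2 in if i.2 then p1.1 else p1.2.

Lemma oct_coordD i p q k l :
  oct_coord i p = k -> oct_coord i q = l -> oct_coord i (p + q) = k + l.
Proof. by case: i => [[[] []] []] <- <-. Qed.

Lemma oct_coordN i p k : oct_coord i p = k -> oct_coord i (- p) = - k.
Proof. by case: i => [[[] []] []] <-. Qed.

Lemma oct_coordZ i k p l : oct_coord i p = l -> oct_coord i (k *: p) = k * l.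
Proof. by case: i => [[[] []] []] <-. Qed.

Lemma oct_coord0 i : oct_coord i (0 : octonion R) = 0.
Proof. by case: i => [[[] []] []]. Qed.

Lemma oct_coord_inj p q : (forall i, oct_coord i p = oct_coord i q) -> p = q.
Proof.
move: p q => [[[? ?] [? ?]] [[? ?] [? ?]]] [[[? ?] [? ?]] [[? ?] [? ?]]] h.
move: (h (true, true, true)) (h (true, true, false)) (h (true, false, true)).
move: (h (true, false, false)) (h (false, true, true)) (h (false, true, false)).
move: (h (false, false, true)) (h (false, false, false)).
by rewrite /oct_coord /= => -> -> -> -> -> -> -> ->.
Qed.

Definition oct_dot p q : R := oct_Re (omul p (oct_conj q)).

End Coordinates.

Ltac oct_coord_eval :=
  lazymatch goal with |- @oct_coord ?R _ ?t = _ =>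
    lazymatch t with
    | GRing.add _ _ => refine (oct_coordD _ _); oct_coord_eval
    | GRing.opp _ => refine (oct_coordN _); oct_coord_eval
    | GRing.scale _ _ => refine (oct_coordZ _ _); oct_coord_eval
    | GRing.zero => exact (@oct_coord0 R _)
    | _ => reflexivity
    end
  end.

(* Proves the identities that hold in any real vector space.  The coordinates
   are computed by syntax-directed resolution: rewriting would make the unifier
   compare vectors by unfolding the operations of the product space. *)
Ltac oct_linear :=
  repeat match goal with
  | |- context [oct_Re ?p] => generalize (oct_Re p); intro
  | |- context [oct_dot ?p ?q] => generalize (oct_dot p q); intro
  | |- context [oct_sqnorm ?p] => generalize (oct_sqnorm p); intro
  | |- context [omul ?p ?q] => generalize (omul p q); intro
  | |- context [oct_conj ?p] => generalize (oct_conj p); intro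
  end;
  apply: oct_coord_inj => ?;
  refine (etrans (_ : oct_coord _ _ = _)
                 (etrans _ (esym (_ : oct_coord _ _ = _))));
  [oct_coord_eval | | oct_coord_eval];
  repeat match goal with
  | |- context [oct_coord ?i ?p] => generalize (oct_coord i p); intro
  end; ring.

Ltac oct_expand :=
  rewrite ?(omulDl, omulDr, omulZl, omulZr, omulNl, omulNr,
            omul1l, omul_realr, oct_conjD, oct_conjZ, omul0l, omul0r).

(** * Polarisation and anticommuting left multiplications *)

Section InnerProduct.
Variable R : realType.
Implicit Types (p q t x : octonion R) (k : R).

Lemma oct_dotDl p q t : oct_dot (p + q) t = oct_dot p t + oct_dot q t.
Proof. by rewrite /oct_dot omulDl oct_ReD. Qed.

Lemma oct_dotZl k p q : oct_dot (k *: p) q = k * oct_dot p q.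
Proof. by rewrite /oct_dot omulZl oct_ReZ. Qed.

Lemma oct_dotC p q : oct_dot p q = oct_dot q p.
Proof. by rewrite /oct_dot -oct_Re_conj oct_conjM oct_conjK. Qed.

Lemma oct_dotpp p : oct_dot p p = oct_sqnorm p.
Proof. by rewrite /oct_dot omul.unlock. Qed.

Lemma oct_dot1l p : oct_dot (oct_real 1) p = oct_Re p.
Proof. by rewrite /oct_dot omul1l. Qed.

(** Polarisation of [omulKl]: expand it at [p + q], then subtract the cases [p] and [q]. *)
Lemma omul_polar p q x :
  omul (oct_conj p) (omul q x) + omul (oct_conj q) (omul p x) =
  (2 * oct_dot p q) *: x.
Proof.
have := omulKl (p + q) x; rewrite -oct_dotpp.
rewrite !(oct_dotDl, oct_dotC _ (p + q)) (oct_dotC q p) !oct_dotpp.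
oct_expand; rewrite !omulKl => h.
transitivity ((oct_sqnorm p + oct_dot p q + (oct_dot p q + oct_sqnorm q)) *: x
              - oct_sqnorm p *: x - oct_sqnorm q *: x).
  by rewrite -h; oct_linear.
by oct_linear.
Qed.

Lemma oct_sqnormZ k p : oct_sqnorm (k *: p) = k ^+ 2 * oct_sqnorm p.
Proof.
by rewrite -!oct_dotpp oct_dotZl oct_dotC oct_dotZl expr2 mulrA.
Qed.

Lemma imag_conj p : oct_Re p = 0 -> oct_conj p = - p.
Proof.
rewrite oct_conj_Re => ->; rewrite mulr0.
by rewrite -(omul1l (oct_real 0)) omul_realr scale0r sub0r.
Qed.

Lemma imag_mulK p x :
  oct_Re p = 0 -> omul p (omul p x) = - (oct_sqnorm p *: x).
Proof.
by move/imag_conj=> pI; rewrite -omulKl pI omulNl opprK.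
Qed.

(** For imaginary [p] and [q], conjugation is a sign and [omul_polar] becomes the Clifford
    relation. *)
Lemma imag_anticomm p q x :
    oct_Re p = 0 -> oct_Re q = 0 -> oct_dot p q = 0 ->
  omul p (omul q x) = - omul q (omul p x).
Proof.
move=> /imag_conj pI /imag_conj qI pq0; have := omul_polar p q x.
rewrite pI qI pq0 mulr0 scale0r !omulNl => /eqP.
by rewrite -opprD oppr_eq0 addr_eq0 => /eqP.
Qed.

End InnerProduct.

(* The trilinear alternating maps that vanish when an argument is real, that is
   the alternating 3-forms on the imaginary octonions. *)
Record alt3 (R : realType)
    (f : octonion R -> octonion R -> octonion R -> octonion R) : Prop := Alt3 {
  alt3_lin1 : forall k p p' q t, f (k *: p + p') q t = k *: f p q t + f p' q t;
  alt3_lin2 : forall k p q q' t, f p (k *: q + q') t = k *: f p q t + f p q' t;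
  alt3_lin3 : forall k p q t t', f p q (k *: t + t') = k *: f p q t + f p q t';
  alt3_ppq : forall p q, f p p q = 0;
  alt3_pqq : forall p q, f p q q = 0;
  alt3_1pq : forall p q, f (oct_real 1) p q = 0 }.

(** * Symmetries of alternating 3-forms *)

Section AlternatingForms.
Variable R : realType.
Implicit Types (p q t x y a b c : octonion R) (k : R).
Variable f : octonion R -> octonion R -> octonion R -> octonion R.
Hypothesis fA : alt3 f.

Lemma alt3_swap12 p q t : f q p t = - f p q t.
Proof.
have := alt3_ppq fA (1 *: p + q) t.
rewrite (alt3_lin1 fA) !(alt3_lin2 fA) !(alt3_ppq fA) !scale1r.
by rewrite add0r addr0 addrC => /eqP; rewrite addr_eq0 => /eqP.
Qed.

Lemma alt3_swap23 p q t : f p t q = - f p q t.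
Proof.
have := alt3_pqq fA p (1 *: q + t).
rewrite (alt3_lin2 fA) !(alt3_lin3 fA) !(alt3_pqq fA) !scale1r.
by rewrite add0r addr0 addrC => /eqP; rewrite addr_eq0 => /eqP.
Qed.

Lemma alt3_cycle p q t : f q t p = f p q t.
Proof. by rewrite alt3_swap23 alt3_swap12 opprK. Qed.

Lemma alt3_pqp p q : f p q p = 0.
Proof. by rewrite alt3_cycle (alt3_ppq fA). Qed.

Lemma alt3_p1q p q : f p (oct_real 1) q = 0.
Proof. by rewrite alt3_swap12 (alt3_1pq fA) oppr0. Qed.

Lemma alt3_pq1 p q : f p q (oct_real 1) = 0.
Proof. by rewrite alt3_swap23 alt3_p1q oppr0. Qed.

Definition alt3_vanish :=
  (alt3_ppq fA, alt3_pqq fA, alt3_1pq fA, alt3_pqp, alt3_p1q, alt3_pq1,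
   scaler0, add0r).

(* The arguments are shifted as in the Gram-Schmidt process applied to
   [1, a, b, c]. *)
Lemma alt3_shear (k0 k1 k2 k3 k4 k5 : R) a b c a' b' c' :
    a' = k0 *: oct_real 1 + a ->
    b' = k1 *: oct_real 1 + (k2 *: a' + b) ->
    c' = k3 *: oct_real 1 + (k4 *: a' + (k5 *: b' + c)) ->
  f a b c = f a' b' c'.
Proof.
(* The third argument is expanded first, while [a'] and [b'] are still atoms, so that repeated
   arguments are visible. *)
move=> a'E b'E ->; rewrite !(alt3_lin3 fA) !alt3_vanish b'E.
by rewrite !(alt3_lin2 fA) !alt3_vanish a'E (alt3_lin1 fA) !alt3_vanish.
Qed.

End AlternatingForms.

(** * The span of 1, a, b, c and alternating forms on it *)

Definition span3 (R : realType) (a b c p : octonion R) : Prop :=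
  exists k0 k1 k2 k3,
    p = k0 *: oct_real 1 + (k1 *: a + (k2 *: b + (k3 *: c + 0))).

Section Span.
Variable R : realType.
Implicit Types (p q t x y a b c : octonion R) (k : R).

Lemma span3_ind a b c (P : octonion R -> Prop) :
    (forall k p q, P p -> P q -> P (k *: p + q)) ->
    P (oct_real 1) -> P a -> P b -> P c ->
  forall p, span3 a b c p -> P p.
Proof.
move=> Plin P1 Pa Pb Pc p [k0 [k1 [k2 [k3 ->]]]].
do 4!apply: (Plin) => //.
(* The trailing zero in [span3] gives every term the shape [k *: p + q]. There remains [P 0],
   reached as [-1 *: a + a]. *)
by rewrite -(addNr a) -scaleN1r; apply: Plin.
Qed.

(** By linearity the arguments may be taken among 1, [a], [b], [c]; such a triple contains 1, has a
    repetition, or permutes [(a, b, c)]. *)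
Lemma alt3_span f a b c p q t :
    alt3 f -> f a b c = 0 ->
    span3 a b c p -> span3 a b c q -> span3 a b c t ->
  f p q t = 0.
Proof.
move=> fA fabc hp hq ht.
have h0 k : k *: (0 : octonion R) + 0 = 0 by rewrite scaler0 addr0.
move: p hp; apply: span3_ind => [k p p' h h'||||].
- by rewrite (alt3_lin1 fA) h h' h0.
- by rewrite (alt3_1pq fA).
all: move: q hq; apply: span3_ind => [k q q' h h'||||];
  [by rewrite (alt3_lin2 fA) h h' h0|..].
all: move: t ht; apply: span3_ind => [k t t' h h'||||];
  [by rewrite (alt3_lin3 fA) h h' h0|..].
all: rewrite ?(alt3_vanish fA) //.
- by rewrite alt3_swap23 // fabc oppr0.
- by rewrite alt3_swap12 // fabc oppr0.
- by rewrite (alt3_cycle fA a).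
- by rewrite -(alt3_cycle fA c).
- by rewrite (alt3_swap12 fA b) (alt3_cycle fA a) fabc oppr0.
Qed.

End Span.

(** * The associator, the characteristic block and the triple product defect *)

Definition oct_assoc (R : realType) (p q t : octonion R) : octonion R :=
  omul (omul p q) t - omul p (omul q t).

(* The diagonal entries of the characteristic operator are
   [char_form a c b], [char_form c b a] and [char_form b a c]. *)
Definition char_form (R : realType) (x p q t : octonion R) : octonion R :=
  omul p (omul q (omul t x))
  + omul (oct_conj t) (omul (oct_conj q) (omul (oct_conj p) x))
  - (2 * oct_Re (omul p (omul q t))) *: x.

(* With [x = p y], [z = q y], [w = t y] and [y] nonzero, this vanishes if and
   only if [(x y')((y z') w) = |y|^2 ((x z') w)], where ['] is conjugation. *)
Definition triple_form (R : realType) (y p q t : octonion R) : octonion R :=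
  oct_sqnorm y *: omul p (omul (oct_conj q) (omul t y))
  - omul (omul (omul p y) (oct_conj (omul q y))) (omul t y).

Section Forms.
Variable R : realType.
Implicit Types (p q t x y a b c : octonion R) (k : R).

(** Alternation is the two alternative laws. This carries the nonvanishing of alpha over to an
    orthogonal frame. *)
Lemma oct_assoc_alt3 : alt3 (@oct_assoc R).
Proof.
split; rewrite /oct_assoc.
- by move=> k p p' q t; oct_expand; oct_linear.
- by move=> k p p' q t; oct_expand; oct_linear.
- by move=> k p p' q t; oct_expand; oct_linear.
- by move=> p q; rewrite omul_alternative subrr.
- by move=> p q; rewrite omul_ralternative subrr.
- by move=> p q; rewrite !omul1l subrr.
Qed.

(** In each degenerate case alternativity merges two factors, leaving [u (w x) + w' (u' x)] with '
    for conjugation; [omul_polar] evaluates this to [2 Re(u w) x]. *)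
Lemma char_form_alt3 x : alt3 (char_form x).
Proof.
split; rewrite /char_form.
- by move=> k p p' q t; oct_expand; rewrite oct_ReD oct_ReZ; oct_linear.
- by move=> k p p' q t; oct_expand; rewrite oct_ReD oct_ReZ; oct_linear.
- by move=> k p p' q t; oct_expand; rewrite oct_ReD oct_ReZ; oct_linear.
- move=> p q; rewrite !omul_alternative -oct_conjM.
  rewrite -{1}(oct_conjK (omul p p)) omul_polar.
  by rewrite /oct_dot -oct_conjM oct_Re_conj oct_Re_mulC subrr.
- move=> p q; rewrite !omul_alternative -oct_conjM.
  rewrite -{1}(oct_conjK p) omul_polar.
  by rewrite /oct_dot -oct_conjM oct_Re_conj oct_Re_mulC subrr.
- move=> p q; rewrite oct_conj1 !omul1l -{1}(oct_conjK p) omul_polar.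
  by rewrite /oct_dot -oct_conjM oct_Re_conj oct_Re_mulC subrr.
Qed.

(** Equal neighbouring arguments reduce to multiplicativity of the norm; for a real first argument
    [y] cancels against its conjugate. *)
Lemma triple_form_alt3 y : alt3 (triple_form y).
Proof.
split; rewrite /triple_form.
- by move=> k p p' q t; oct_expand; oct_linear.
- by move=> k p p' q t; oct_expand; oct_linear.
- by move=> k p p' q t; oct_expand; oct_linear.
- move=> p q; rewrite omulVKl omul_norm omulZl omul1l omul_sqnorm.
  by rewrite scalerA mulrC subrr.
- move=> p q; rewrite omulKl omulVKr omulZr scalerA omul_sqnorm.
  by rewrite mulrC subrr.
- move=> p q; rewrite !omul1l oct_conjM.
  by rewrite omulVKl omulZl subrr.
Qed.

End Forms.

Opaque oct_dot oct_sqnorm.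

(** * Orthogonal imaginary frames *)

Record oct_frame (R : realType) (a b c : octonion R) : Prop := OctFrame {
  frame_Re1 : oct_Re a = 0;
  frame_Re2 : oct_Re b = 0;
  frame_Re3 : oct_Re c = 0;
  frame_dot12 : oct_dot a b = 0;
  frame_dot13 : oct_dot a c = 0;
  frame_dot23 : oct_dot b c = 0 }.

Lemma scaler_div (F : fieldType) (V : lmodType F) (k l : F) (x y : V) :
  k != 0 -> k *: x = l *: y -> x = (l / k) *: y.
Proof.
by move=> k0 kxE; rewrite mulrC -scalerA -kxE scalerA mulVf // scale1r.
Qed.

Section Frames.
Variable R : realType.
Implicit Types (p q t x y z w a b c : octonion R) (k s : R).

Lemma oct_sqnorm_neq0 p : p <> 0 -> oct_sqnorm p != 0.
Proof. by move=> p0; apply/eqP => /oct_sqnorm_eq0. Qed.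

Lemma oct_sqnorm0 : oct_sqnorm (0 : octonion R) = 0.
Proof. by rewrite -(scale0r 0) oct_sqnormZ expr0n mul0r. Qed.

Lemma oct_conj0 : oct_conj 0 = 0 :> octonion R.
Proof. by rewrite -(scale0r 0) oct_conjZ !scale0r. Qed.

Lemma oct_dot0r p : oct_dot p 0 = 0.
Proof. by rewrite oct_dotC -(scale0r 0) oct_dotZl mul0r. Qed.

Lemma oct_Re1 : oct_Re (oct_real 1 : octonion R) = 1.
Proof. by []. Qed.

Lemma projection_exists p q : exists k, - k * oct_sqnorm q + oct_dot p q = 0.
Proof.
have [/eqP/oct_sqnorm_eq0 ->|q0] := boolP (oct_sqnorm q == 0).
  by exists 0; rewrite oct_dot0r oppr0 mul0r addr0.
by exists (oct_dot p q / oct_sqnorm q); rewrite mulNr divfK ?addNr.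
Qed.

(** Gram-Schmidt on 1, [a], [b], [c]. The same frame serves all forms: the associator, and
    [char_form x] for every [x]. *)
Lemma frame_exists a b c :
  exists a' b' c', oct_frame a' b' c' /\
    forall f, alt3 f -> f a b c = f a' b' c' :> octonion R.
Proof.
have [a' a'E] : exists x, x = - oct_Re a *: oct_real 1 + a by eexists.
have ra : oct_Re a' = 0 by rewrite a'E oct_ReD oct_ReZ oct_Re1 mulr1 addNr.
have [k0 k0E] := projection_exists b a'.
have [b' b'E] : exists x, x = - oct_Re b *: oct_real 1 + (- k0 *: a' + b).
  by eexists.
have rb : oct_Re b' = 0.
  by rewrite b'E !(oct_ReD, oct_ReZ) oct_Re1 ra; ring.
have ab : oct_dot b' a' = 0.
  rewrite b'E !(oct_dotDl, oct_dotZl) oct_dot1l ra mulr0 add0r oct_dotpp.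
  exact: k0E.
have [k1 k1E] := projection_exists c a'.
have [k2 k2E] := projection_exists c b'.
have [c' c'E] : exists x,
    x = - oct_Re c *: oct_real 1 + (- k1 *: a' + (- k2 *: b' + c)).
  by eexists.
have rc : oct_Re c' = 0.
  by rewrite c'E !(oct_ReD, oct_ReZ) oct_Re1 ra rb; ring.
have ac : oct_dot c' a' = 0.
  rewrite c'E !(oct_dotDl, oct_dotZl) oct_dot1l ra ab !mulr0 !add0r.
  rewrite oct_dotpp; exact: k1E.
have bc : oct_dot c' b' = 0.
  rewrite c'E !(oct_dotDl, oct_dotZl) oct_dot1l rb (oct_dotC a') ab !mulr0.
  rewrite !add0r oct_dotpp; exact: k2E.
exists a', b', c'; split; last first.
  by move=> f fA; exact: (alt3_shear fA a'E b'E c'E).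
exact: OctFrame ra rb rc (etrans (oct_dotC _ _) ab) (etrans (oct_dotC _ _) ac)
                (etrans (oct_dotC _ _) bc).
Qed.

Lemma frame_anticomm21 a b c x : oct_frame a b c ->
  omul b (omul a x) = - omul a (omul b x).
Proof.
case=> ra rb _ ab _ _.
exact: (imag_anticomm _ rb ra (etrans (oct_dotC _ _) ab)).
Qed.

Lemma frame_anticomm31 a b c x : oct_frame a b c ->
  omul c (omul a x) = - omul a (omul c x).
Proof.
case=> ra _ rc _ ac _.
exact: (imag_anticomm _ rc ra (etrans (oct_dotC _ _) ac)).
Qed.

Lemma frame_anticomm32 a b c x : oct_frame a b c ->
  omul c (omul b x) = - omul b (omul c x).
Proof.
case=> _ rb rc _ _ bc.
exact: (imag_anticomm _ rc rb (etrans (oct_dotC _ _) bc)).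
Qed.

(** Three conjugations give a sign -1, and reversing the order of the factors takes three
    anticommutations, again -1; so the two triple products agree. *)
Lemma char_form_frame x a b c : oct_frame a b c ->
  char_form x a b c =
  2 *: omul a (omul b (omul c x))
  - (2 * oct_Re (omul a (omul b c))) *: x.
Proof.
move=> frame; case: (frame) => ra rb rc _ _ _.
rewrite /char_form (imag_conj ra) (imag_conj rb) (imag_conj rc).
rewrite !(omulNl, omulNr) (frame_anticomm21 _ frame) omulNr.
rewrite (frame_anticomm31 _ frame) (frame_anticomm32 _ frame) omulNr.
by rewrite !opprK; oct_linear.
Qed.

(** * A common eigenspace of L_a L_b L_c *)

Section Eigenspace.
Variables (a b c : octonion R) (s : R).
Hypothesis frame : oct_frame a b c.
Hypotheses (a0 : a <> 0) (b0 : b <> 0) (c0 : c <> 0).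

Let eigen x := omul a (omul b (omul c x)) = s *: x.

Lemma eigen_lin k x y : eigen x -> eigen y -> eigen (k *: x + y).
Proof. by rewrite /eigen => hx hy; oct_expand; rewrite hx hy; oct_linear. Qed.

(** Left multiplication by a frame element anticommutes with two of the three factors and commutes
    with itself, hence commutes with their product. *)
Lemma eigen_frame1 y : eigen y -> eigen (omul a y).
Proof.
rewrite /eigen => hy; rewrite (frame_anticomm31 _ frame) omulNr.
by rewrite (frame_anticomm21 _ frame) opprK hy omulZr.
Qed.

Lemma eigen_frame2 y : eigen y -> eigen (omul b y).
Proof.
rewrite /eigen => hy; rewrite (frame_anticomm32 _ frame) !omulNr.
by rewrite -(frame_anticomm21 _ frame) hy omulZr.
Qed.

Lemma eigen_frame3 y : eigen y -> eigen (omul c y).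
Proof.
rewrite /eigen => hy; rewrite -omulZr -hy (frame_anticomm31 _ frame).
by rewrite (frame_anticomm32 _ frame) omulNr opprK.
Qed.

Lemma eigenvalue_neq0 y : eigen y -> y <> 0 -> s != 0.
Proof.
move=> hy y0; apply/eqP => s0; move: hy; rewrite /eigen s0 scale0r.
move/(congr1 (@oct_sqnorm R)); rewrite oct_sqnorm0 !omul_sqnorm => /eqP.
by rewrite !mulf_eq0 !(negbTE (oct_sqnorm_neq0 _)).
Qed.

(* Write [x = p y] with [p = x y^-1].  The component [p'] of [p] orthogonal to
   [1, a, b, c] anticommutes with each of [a, b, c] under left multiplication,
   so [p' y] belongs to the eigenvalues [s] and [- s] at once. *)
Lemma eigen_span x y : eigen x -> eigen y -> y <> 0 ->
  exists2 p, span3 a b c p & x = omul p y.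
Proof.
move=> hx hy y0; case: (frame) => ra rb rc ab ac bc.
have n0 := oct_sqnorm_neq0 y0.
have [p pE] : exists q, q = (oct_sqnorm y)^-1 *: omul x (oct_conj y).
  by eexists.
have xE : x = omul p y.
  rewrite pE omulZl omulVKr scalerA (mulVf n0) scale1r; reflexivity.
have [ka kaE] := projection_exists p a.
have [kb kbE] := projection_exists p b.
have [kc kcE] := projection_exists p c.
have [p' p'E] : exists q, q =
    - oct_Re p *: oct_real 1 + (- ka *: a + (- kb *: b + (- kc *: c + p))).
  by eexists.
have rp : oct_Re p' = 0.
  by rewrite p'E !(oct_ReD, oct_ReZ) oct_Re1 ra rb rc; ring.
have pa : oct_dot p' a = 0.
  rewrite p'E !(oct_dotDl, oct_dotZl) oct_dot1l ra !(oct_dotC _ a) ab ac.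
  rewrite !mulr0 !add0r oct_dotpp oct_dotC; exact: kaE.
have pb : oct_dot p' b = 0.
  rewrite p'E !(oct_dotDl, oct_dotZl) oct_dot1l rb ab (oct_dotC c) bc.
  rewrite !mulr0 !add0r oct_dotpp; exact: kbE.
have pc : oct_dot p' c = 0.
  rewrite p'E !(oct_dotDl, oct_dotZl) oct_dot1l rc ac bc.
  rewrite !mulr0 !add0r oct_dotpp; exact: kcE.
have hp' : eigen (omul p' y).
  have -> : omul p' y = - ka *: omul a y + (- kb *: omul b y +
      (- kc *: omul c y + (- oct_Re p *: y + omul p y))).
    rewrite p'E !omulDl !omulZl omul1l; oct_linear.
  rewrite -xE; exact: (eigen_lin _ (eigen_frame1 hy)
    (eigen_lin _ (eigen_frame2 hy) (eigen_lin _ (eigen_frame3 hy)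
    (eigen_lin _ hy hx)))).
have p'y0 : omul p' y = 0.
  have cp := imag_anticomm y rc rp (etrans (oct_dotC _ _) pc).
  have bp := imag_anticomm (omul c y) rb rp (etrans (oct_dotC _ _) pb).
  have ap := imag_anticomm (omul b (omul c y)) ra rp
    (etrans (oct_dotC _ _) pa).
  have h := hp'; move: h; rewrite /eigen cp omulNr bp !omulNr opprK ap.
  rewrite hy omulZr => h.
  have : (2 * s) *: omul p' y = 0.
    by rewrite mulr_natl mulr2n scalerDl -{1}h addNr.
  move/eqP; rewrite scaler_eq0 mulf_eq0 (negbTE (eigenvalue_neq0 hy y0)).
  rewrite pnatr_eq0 => /eqP; exact: id.
(* Since [p' y] vanishes, [x] is also [(p - p') y], and [p - p'] lies in the span by
   construction. *)
exists (p - p').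
  by exists (oct_Re p), ka, kb, kc; rewrite p'E; oct_linear.
by rewrite omulDl omulNl p'y0 subr0.
Qed.

Lemma triple_form_frame y : eigen y -> triple_form y a b c = 0.
Proof.
case: frame => ra rb rc ab ac bc hy.
have nab : oct_sqnorm a * oct_sqnorm b != 0.
  by rewrite mulf_eq0 !(negbTE (oct_sqnorm_neq0 _)).
(* Apply L_b L_a to the eigenvalue equation: as L_a and L_b square to minus the norms, the left side
   becomes [|a|^2 |b|^2 (c y)]. *)
have [g sE cyE] : exists2 g, s = g * (oct_sqnorm a * oct_sqnorm b) &
    omul c y = g *: omul b (omul a y).
  exists (s / (oct_sqnorm a * oct_sqnorm b)); first by rewrite divfK.
  have : omul b (omul a (omul a (omul b (omul c y)))) = s *: omul b (omul a y).
    rewrite hy !omulZr; reflexivity.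
  rewrite (imag_mulK _ ra) omulNr omulZr (imag_mulK _ rb) scalerN opprK.
  rewrite scalerA; exact: scaler_div.
rewrite /triple_form (imag_conj rb) omulNl omulNr hy cyE.
have bK : omul (omul (oct_conj y) b) b = - (oct_sqnorm b *: oct_conj y).
  by rewrite -{1}(opprK b) -(imag_conj rb) omulNr omulNl omulVKr.
have aK : omul (omul (omul a y) (oct_conj y)) (omul a y) =
          - ((oct_sqnorm y * oct_sqnorm a) *: y).
  rewrite omulKr.
  by rewrite omulZl (imag_mulK _ ra) scalerN scalerA.
(* Up to scalars the second term is [(p q) (t p)] with [p = a y], [q = y' b], [t = b], where y' is
   the conjugate of [y]; the Moufang identity brings the two factors [b] together. *)
rewrite oct_conjM (imag_conj rb) !omulNr omulZr omulNl omul_moufang bK.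
rewrite omulNr omulNl omulZr omulZl aK sE; oct_linear.
Qed.

Lemma eigen_triple x y z w : eigen x -> eigen y -> eigen z -> eigen w ->
  omul (omul x (oct_conj y)) (omul (omul y (oct_conj z)) w) =
  oct_sqnorm y *: omul (omul x (oct_conj z)) w.
Proof.
move=> hx hy hz hw; have [->|/eqP y0] := eqVneq y 0.
  by rewrite oct_conj0 omul0r !omul0l oct_sqnorm0 scale0r.
have [p ph ->] := eigen_span hx hy y0.
have [q qh ->] := eigen_span hz hy y0.
have [t th ->] := eigen_span hw hy y0.
have := alt3_span (triple_form_alt3 y) (triple_form_frame hy) ph qh th.
(* With ' for conjugation, [x y'] is [|y|^2 p] and [y z'] is [|y|^2 q'], so the goal is [|y|^2]
   times the vanishing of the form. *)
rewrite /triple_form oct_conjM omulVKl omulKr !omulZl omulZr => /eqP.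
rewrite subr_eq0 => /eqP ->; reflexivity.
Qed.

End Eigenspace.
End Frames.

Local Notation i0 := (@Ordinal 3 0 isT).
Local Notation i1 := (@Ordinal 3 1 isT).
Local Notation i2 := (@Ordinal 3 2 isT).

(** * The characteristic operator in components *)

Section CharacteristicOperator.
Variable R : realType.
Implicit Types (p q t : octonion R) (k r : R).

Lemma oct_mulmxE m n o (M : 'M[octonion R]_(m, n)) (N : 'M_(n, o)) i l :
  oct_mulmx M N i l = \sum_j omul (M i j) (N j l).
Proof. by rewrite mxE omul.unlock. Qed.

Lemma ord3_ind (P : 'I_3 -> Prop) : P i0 -> P i1 -> P i2 -> forall i, P i.
Proof.
move=> P0 P1 P2 [[|[|[|//]]] lti].
- by rewrite (_ : Ordinal lti = i0) //; apply: val_inj.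
- by rewrite (_ : Ordinal lti = i1) //; apply: val_inj.
- by rewrite (_ : Ordinal lti = i2) //; apply: val_inj.
Qed.

Lemma sum_ord3 (V : nmodType) (F : 'I_3 -> V) : \sum_i F i = F i0 + F i1 + F i2.
Proof.
rewrite !big_ord_recl big_ord0 addr0 addrA.
by congr (F _ + F _ + F _); apply: val_inj.
Qed.

Variables (d e f : R) (a b c : octonion R).
Let A := oct_herm d e f a b c.
Implicit Types x : 'cV[octonion R]_3.

Lemma herm_mulE0 x :
  oct_mulmx A x i0 0 =
  d *: x i0 0 + omul a (x i1 0) + omul (oct_conj b) (x i2 0).
Proof.
rewrite oct_mulmxE sum_ord3 !mxE /= omul_reall; reflexivity.
Qed.

Lemma herm_mulE1 x :
  oct_mulmx A x i1 0 =
  omul (oct_conj a) (x i0 0) + e *: x i1 0 + omul c (x i2 0).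
Proof.
rewrite oct_mulmxE sum_ord3 !mxE /= omul_reall; reflexivity.
Qed.

Lemma herm_mulE2 x :
  oct_mulmx A x i2 0 =
  omul b (x i0 0) + omul (oct_conj c) (x i1 0) + f *: x i2 0.
Proof.
rewrite oct_mulmxE sum_ord3 !mxE /= omul_reall; reflexivity.
Qed.

Lemma oct_Re_sum9 k1 k2 k3 k4 k5 k6 k7 k8 k9 :
  oct_Re (oct_real k1 + oct_real k2 + oct_real k3
          + (oct_real k4 + oct_real k5 + oct_real k6)
          + (oct_real k7 + oct_real k8 + oct_real k9)) =
  k1 + k2 + k3 + (k4 + k5 + k6) + (k7 + k8 + k9).
Proof. by []. Qed.

Lemma herm_sigmaE : herm_sigma d e f a b c =
  d * e + d * f + e * f - oct_sqnorm a - oct_sqnorm b - oct_sqnorm c.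
Proof.
have realM k : omul (oct_real k) (oct_real k) = oct_real (k * k).
  rewrite omul_reall; do 3?[congr pair] => /=;
    by rewrite /GRing.scale /= ?mulr0.
have normE p : omul p (oct_conj p) = oct_real (oct_sqnorm p).
  by rewrite omul.unlock oct_sqnormE.
have normE' p : omul (oct_conj p) p = oct_real (oct_sqnorm p).
  by rewrite omul.unlock oct_conj_mul.
rewrite /herm_sigma /mxtrace sum_ord3 !oct_mulmxE !sum_ord3 !mxE /=.
rewrite (realM d) (realM e) (realM f) (normE a) (normE b) (normE c).
rewrite (normE' a) (normE' b) (normE' c).
rewrite oct_Re_sum9 /herm_tr.
by move: (oct_sqnorm a) (oct_sqnorm b) (oct_sqnorm c) => na nb nc; field.
Qed.

Lemma mx_combE (V : zmodType) m n (X Y Z W : 'M[V]_(m, n)) i j :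
  (X - Y + Z - W) i j = X i j - Y i j + Z i j - W i j.
Proof. by rewrite !mxE. Qed.

Lemma oct_scalemxE m n k (M : 'M[octonion R]_(m, n)) i j :
  oct_scalemx k M i j = k *: M i j.
Proof. by rewrite mxE. Qed.

Lemma scalemx_combE n (X Y Z W : 'cV[octonion R]_n) k1 k2 k3 i :
  (X - oct_scalemx k1 Y + oct_scalemx k2 Z - oct_scalemx k3 W) i 0 =
  X i 0 - k1 *: Y i 0 + k2 *: Z i 0 - k3 *: W i 0.
Proof.
rewrite mx_combE (oct_scalemxE k1 Y) (oct_scalemxE k2 Z) (oct_scalemxE k3 W).
reflexivity.
Qed.

(** In A(A(Ax)), products that use a diagonal entry or an entry next to its conjugate cancel against
    the lower terms of K. Only the two 3-cycles through each index survive, with the real part from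
    the determinant. *)
Lemma char_opE x :
  [/\ char_op d e f a b c x i0 0 = char_form (x i0 0) a c b,
      char_op d e f a b c x i1 0 = char_form (x i1 0) c b a &
      char_op d e f a b c x i2 0 = char_form (x i2 0) b a c].
Proof.
have detE : herm_det d e f a b c = d * e * f
    + 2 * oct_Re (omul b (omul a c))
    - d * oct_sqnorm c - e * oct_sqnorm b - f * oct_sqnorm a.
  by rewrite omul.unlock.
(* The real part in the determinant is cyclically invariant, so it fits all three blocks. *)
have detE1 : oct_Re (omul b (omul a c)) = oct_Re (omul a (omul c b)).
  by rewrite oct_Re_mulC oct_Re_mulA.
have detE2 : oct_Re (omul b (omul a c)) = oct_Re (omul c (omul b a)).
  by rewrite oct_Re_mulA oct_Re_mulC.
split; rewrite /char_form scalemx_combE -/A.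
- rewrite herm_mulE0 (herm_mulE0 (oct_mulmx A x)) (herm_mulE1 (oct_mulmx A x)).
  rewrite (herm_mulE2 (oct_mulmx A x)).
  rewrite herm_mulE0 herm_mulE1 herm_mulE2 herm_sigmaE detE detE1 /herm_tr.
  move: (x i0 0) (x i1 0) (x i2 0) => x0 x1 x2.
  by oct_expand; rewrite ?(omulKl, omulVKl) ?omulZr; oct_linear.
- rewrite herm_mulE1 (herm_mulE0 (oct_mulmx A x)) (herm_mulE1 (oct_mulmx A x)).
  rewrite (herm_mulE2 (oct_mulmx A x)).
  rewrite herm_mulE0 herm_mulE1 herm_mulE2 herm_sigmaE detE detE2 /herm_tr.
  move: (x i0 0) (x i1 0) (x i2 0) => x0 x1 x2.
  by oct_expand; rewrite ?(omulKl, omulVKl) ?omulZr; oct_linear.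
- rewrite herm_mulE2 (herm_mulE0 (oct_mulmx A x)) (herm_mulE1 (oct_mulmx A x)).
  rewrite (herm_mulE2 (oct_mulmx A x)).
  rewrite herm_mulE0 herm_mulE1 herm_mulE2 herm_sigmaE detE /herm_tr.
  move: (x i0 0) (x i1 0) (x i2 0) => x0 x1 x2.
  by oct_expand; rewrite ?(omulKl, omulVKl) ?omulZr; oct_linear.
Qed.

End CharacteristicOperator.

(** * From eigenvectors of K to the outer product identity *)

Section Eigenvectors.
Variable R : realType.
Implicit Types (a b c : octonion R) (r : R).

(** The three blocks carry the odd permutations of [(a, b, c)], so by alternation each is
    [- char_form] at [(a, b, c)]. *)
Lemma char_op_eigen d e f a b c r (x : 'cV[octonion R]_3) :
    char_op d e f a b c x = oct_scalemx r x ->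
  forall i, char_form (x i 0) a b c = - (r *: x i 0).
Proof.
move=> Kx; have [K0 K1 K2] := char_opE d e f a b c x.
have rE i : char_op d e f a b c x i 0 = r *: x i 0.
  by rewrite Kx oct_scalemxE.
have fA i := char_form_alt3 (x i 0).
apply: ord3_ind; rewrite -rE.
- rewrite K0 (alt3_swap23 (fA i0) a c b); reflexivity.
- rewrite K1 (alt3_swap12 (fA i1) b a c) (alt3_cycle (fA i1) c b a).
  reflexivity.
- rewrite K2 (alt3_swap12 (fA i2) b a c); reflexivity.
Qed.

Lemma outer_mulE (v y : 'cV[octonion R]_3) i :
  oct_mulmx (oct_mulmx v (oct_adjmx v)) y i 0 =
  \sum_k omul (omul (v i 0) (oct_conj (v k 0))) (y k 0).
Proof.
rewrite oct_mulmxE; apply: eq_bigr => k _; congr omul.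
by rewrite oct_mulmxE big_ord1 !mxE.
Qed.

Lemma omul_suml (I : finType) (F : I -> octonion R) p :
  omul p (\sum_i F i) = \sum_i omul p (F i).
Proof. exact: (big_morph (omul p) (omulDr p) (omul0r p)). Qed.

Lemma outer_sq (v y : 'cV[octonion R]_3) :
    (forall i j k, omul (omul (v i 0) (oct_conj (v j 0)))
                        (omul (omul (v j 0) (oct_conj (v k 0))) (y k 0)) =
                   oct_sqnorm (v j 0) *:
                   omul (omul (v i 0) (oct_conj (v k 0))) (y k 0)) ->
  let vvd := oct_mulmx v (oct_adjmx v) in
  oct_mulmx vvd (oct_mulmx vvd y) =
  oct_scalemx (oct_vsqnorm v) (oct_mulmx vvd y).
Proof.
move=> vvy vvd; apply/matrixP => i l; rewrite (ord1 l) oct_scalemxE.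
rewrite oct_vsqnorm_sum scaler_suml outer_mulE; apply: eq_bigr => j _.
rewrite !outer_mulE omul_suml scaler_sumr; apply: eq_bigr => k _; exact: vvy.
Qed.

End Eigenvectors.

Theorem theorem1 (R : realType) (d e f : R) (a b c : octonion R)
    (halpha : oct_mul (oct_mul a b) c - oct_mul a (oct_mul b c) <> 0)
    (v : 'cV[octonion R]_3) (lambda r : R)
    (hv0 : v <> 0)
    (hAv : oct_mulmx (oct_herm d e f a b c) v = oct_scalemx lambda v)
    (hKv : char_op d e f a b c v = oct_scalemx r v)
    (y : 'cV[octonion R]_3)
    (hyv : y <> v)
    (hKy : char_op d e f a b c y = oct_scalemx r y) :
  let vvd := oct_mulmx v (oct_adjmx v) in
  oct_mulmx vvd (oct_mulmx vvd y) =
  oct_scalemx (oct_vsqnorm v) (oct_mulmx vvd y).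
Proof.
have [a' [b' [c' [frame formE]]]] := frame_exists a b c.
have assoc0 : oct_assoc a' b' c' <> 0.
  rewrite -(formE _ (oct_assoc_alt3 R)) /oct_assoc omul.unlock; exact: halpha.
have a0 : a' <> 0.
  by move=> a0; apply: assoc0; rewrite /oct_assoc a0 !omul0l subrr.
have b0 : b' <> 0.
  move=> b0; apply: assoc0.
  by rewrite /oct_assoc b0 omul0r !omul0l omul0r subrr.
have c0 : c' <> 0.
  by move=> c0; apply: assoc0; rewrite /oct_assoc c0 !omul0r subrr.
(* Solves [2 a'(b'(c' x)) - 2 Re(a'(b' c')) x = - r x] for the triple product. *)
pose s := oct_Re (omul a' (omul b' c')) - r / 2.
have eigen (x : 'cV[octonion R]_3) i :
    char_op d e f a b c x = oct_scalemx r x ->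
    omul a' (omul b' (omul c' (x i 0))) = s *: x i 0.
  move/char_op_eigen/(_ i); rewrite (formE _ (char_form_alt3 _)).
  rewrite (char_form_frame _ frame) /s.
  move: (oct_Re _) => k; move: (omul a' _) => p; move: (x i 0) => q h.
  transitivity (2^-1 *: (2 *: p - (2 * k) *: q) + k *: q).
    rewrite scalerBr !scalerA mulrA mulVf ?pnatr_eq0 // mul1r scale1r subrK.
    reflexivity.
  rewrite h; oct_linear.
apply: outer_sq => i j k.
exact: (eigen_triple frame a0 b0 c0 (eigen v i hKv) (eigen v j hKv)
  (eigen v k hKv) (eigen y k hKy)).
Qed.
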